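(* Let $\mathbb{K}\in\{\mathbb{R},\mathbb{C}\}$, let $S\subseteq\mathbb{K}$ be a finite set, and let $f\in\mathbb{K}[x_1,\dots,x_n]$ be a homogeneous polynomial of degree $3$. Run the following randomized algorithm on $f$: pick a matrix $R\in M_n(\mathbb{K})$ whose entries $r_{ij}$ are chosen uniformly and independently at random from $S$, set $h(x)=f(Rx)$, and let $T_1,T_2,T_3$ be the first three slices of $h$. If $T_1$ is singular, reject. Otherwise compute $T_1'=T_1^{-1}$, and accept if and only if $T_1'T_2$ and $T_1'T_3$ commute and $T_1'T_2$ is diagonalisable over $\mathbb{K}$. Then: (i) if $f$ is not equivalent to a sum of cubes, the algorithm rejects $f$ with probability at least $1-\frac{2}{|S|}$; (ii) if $f$ is equivalent to a sum of $n$ cubes, the algorithm accepts $f$ with probability at least $1-\frac{2n}{|S|}$.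
   Context: For a homogeneous polynomial $g$ of degree $3$ in $n$ variables, let $(T_{ijk})_{1\le i,j,k\le n}$ be the unique symmetric tensor with $g=\sum_{i,j,k=1}^n T_{ijk}x_ix_jx_k$; its $k$-th slice is the symmetric matrix $T_k=(T_{ijk})_{1\le i,j\le n}$. The polynomial $g$ is ''equivalent to a sum of cubes'' if $g(x)=P_3(Ax)$ for some invertible $A\in M_n(\mathbb{K})$, where $P_3=x_1^3+\cdots+x_n^3$. *)

(* Defs.v *)
From HB Require Import structures.
From mathcomp Require Import all_boot all_order all_algebra.
From mathcomp Require Import finmap boolp classical_sets reals complex.
From mathcomp Require Import mpoly ring.

Set Implicit Arguments.
Unset Strict Implicit.
Unset Printing Implicit Defensive.

Import Order.TTheory GRing.Theory Num.Theory.
Local Open Scope ring_scope.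

Section Cubics.
Variables (K : fieldType) (n : nat).
Implicit Types (f g h : {mpoly K[n]}) (A M : 'M[K]_n).
Implicit Type T : 'I_n -> 'I_n -> 'I_n -> K.

Definition lin_subst f M : {mpoly K[n]} :=
  f \mPo [tuple \sum_(j < n) M i j *: 'X_j | i < n].

Definition P3 : {mpoly K[n]} := \sum_(i < n) 'X_i ^+ 3.

Definition equiv_sum_of_cubes g : Prop :=
  exists2 A : 'M[K]_n, A \in unitmx & g = lin_subst P3 A.

Definition cubic_of_tensor T : {mpoly K[n]} :=
  \sum_(i < n) \sum_(j < n) \sum_(k < n) T i j k *: ('X_i * 'X_j * 'X_k).

(* The two transpositions generate all permutations of the three indices. *)
Definition symmetric_tensor T : Prop :=
  forall i j k, T i j k = T j i k /\ T i j k = T i k j.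

(* The default value 0 is not used when g is a homogeneous cubic and 6 is
   invertible in K; see tensorP and tensor_unique. *)
Definition tensor g : 'I_n -> 'I_n -> 'I_n -> K :=
  xget (fun _ _ _ => 0)
    (fun T => symmetric_tensor T /\ g = cubic_of_tensor T).

Definition slice g (k : 'I_n) : 'M[K]_n := \matrix_(i, j) tensor g i j k.

(* The run of the algorithm on input f when the random matrix is M; the value
   is true for "accept" and false for "reject".  Slices are indexed from 0. *)
Definition accepts (n_ge3 : (3 <= n)%N) f M : bool :=
  let h := lin_subst f M in
  let T1 := slice h (widen_ord n_ge3 (@Ordinal 3 0 isT)) in
  let T2 := slice h (widen_ord n_ge3 (@Ordinal 3 1 isT)) in
  let T3 := slice h (widen_ord n_ge3 (@Ordinal 3 2 isT)) in
  if T1 \in unitmx then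
    let T1' := invmx T1 in
    comm_mxb (T1' *m T2) (T1' *m T3) && `[< diagonalizable (T1' *m T2) >]
  else false.

Definition rejects (n_ge3 : (3 <= n)%N) f M : bool := ~~ accepts n_ge3 f M.

End Cubics.

(* Probability that a random n x n matrix satisfies E, when its entries are
   independent and uniform on S: a matrix r over S has probability
   \prod_(i, j) 1 / #|S|. *)
Definition prob_entries (K : choiceType) (S : {fset K}) (n : nat)
    (E : pred 'M[K]_n) : rat :=
  \sum_(r : 'M[S]_n | E (map_mx val r))
    \prod_(i < n) \prod_(j < n) (#|` S|%:R)^-1.

Section TensorWellDefined.
Variables (K : fieldType) (n : nat).
Implicit Types (g : {mpoly K[n]}) (T : 'I_n -> 'I_n -> 'I_n -> K).

Let d (i j : 'I_n) : K := (i == j)%:R.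

Let sum_d (F : 'I_n -> K) a : \sum_(i < n) F i * d a i = F a.
Proof.
rewrite (bigD1 a) //= /d eqxx mulr1 big1 ?addr0 // => i.
by rewrite eq_sym => /negPf->; rewrite mulr0.
Qed.

Let deriv3 (a b c i j k : 'I_n) :
  (('X_i * 'X_j * 'X_k : {mpoly K[n]})^`M(a)^`M(b)^`M(c))@_0%MM =
  d a i * d b j * d c k + d a i * d c j * d b k + d b i * d a j * d c k
  + d b i * d c j * d a k + d c i * d a j * d b k + d c i * d b j * d a k.
Proof.
have dX (u v : 'I_n) : ('X_u : {mpoly K[n]})^`M(v) = (d v u)%:MP.
  rewrite mderivX mnm1E /d eq_sym.
  case: eqP => [->|_]; last by rewrite mulr0n scale0r mpolyC0.
  by rewrite -[X in (X - _)%MM]add0m addmK mpolyX0 scale1r mpolyC1.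
rewrite !(mderivM, dX, mderivD, mderivC, mul0r, mulr0, add0r, addr0).
rewrite -!mpolyCM -!mpolyCD -!mpolyCM -!mpolyCD mcoeffC eqxx mulr1; ring.
Qed.

Let sum3D (V : nmodType) (F G : 'I_n -> 'I_n -> 'I_n -> V) :
  \sum_(i < n) \sum_(j < n) \sum_(k < n) (F i j k + G i j k) =
  \sum_(i < n) \sum_(j < n) \sum_(k < n) F i j k +
  \sum_(i < n) \sum_(j < n) \sum_(k < n) G i j k.
Proof.
rewrite -big_split /=; apply: eq_bigr => i _.
rewrite -big_split /=; apply: eq_bigr => j _; exact: big_split.
Qed.

Lemma tensor_coefE T a b c : symmetric_tensor T ->
  ((cubic_of_tensor T)^`M(a)^`M(b)^`M(c))@_0%MM = 6%:R * T a b c.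
Proof.
move=> symT; rewrite /cubic_of_tensor.
pose phi (p : {mpoly K[n]}) : K := (p^`M(a)^`M(b)^`M(c))@_0%MM.
rewrite -/(phi _).
have S (F : 'I_n -> {mpoly K[n]}) : phi (\sum_i F i) = \sum_i phi (F i).
  apply: (big_morph phi) => [p q|]; first by rewrite /phi !mderivD mcoeffD.
  by rewrite /phi !mderiv0 mcoeff0.
have E u v w : \sum_(i < n) \sum_(j < n) \sum_(k < n)
    T i j k * (d u i * d v j * d w k) = T u v w.
  transitivity (\sum_(i < n) T i v w * d u i); last exact: (sum_d (fun i => T i v w)).
  apply: eq_bigr => i _.
  rewrite -(sum_d (fun j => T i j w) v) mulr_suml; apply: eq_bigr => j _.
  rewrite -(sum_d (fun k => T i j k) w) !mulr_suml.
  by apply: eq_bigr => k _; ring.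
transitivity (\sum_(i < n) \sum_(j < n) \sum_(k < n)
   (T i j k * (d a i * d b j * d c k) + T i j k * (d a i * d c j * d b k)
  + T i j k * (d b i * d a j * d c k) + T i j k * (d b i * d c j * d a k)
  + T i j k * (d c i * d a j * d b k) + T i j k * (d c i * d b j * d a k))).
  rewrite S; apply: eq_bigr => i _; rewrite S; apply: eq_bigr => j _; rewrite S.
  apply: eq_bigr => k _.
  by rewrite /phi !mderivZ mcoeffZ deriv3; ring.
rewrite !sum3D !E.
have s1 i j k := (symT i j k).1; have s2 i j k := (symT i j k).2.
have e2 : T a c b = T a b c by rewrite s2.
have e3 : T b a c = T a b c by rewrite s1.
have e4 : T b c a = T a b c by rewrite s2.
have e5 : T c a b = T a b c by rewrite s1.
have e6 : T c b a = T a b c by rewrite s1.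
by rewrite e2 e3 e4 e5 e6; ring.
Qed.

Lemma tensor_unique g T T' : 6%:R != 0 :> K ->
  symmetric_tensor T -> g = cubic_of_tensor T ->
  symmetric_tensor T' -> g = cubic_of_tensor T' -> T = T'.
Proof.
move=> nz6 sT -> sT' E; apply/funext => i; apply/funext => j; apply/funext => k.
by apply: (mulfI nz6); rewrite -!tensor_coefE // E.
Qed.

Lemma tensor_exists g : 6%:R != 0 :> K -> g \is 3.-homog ->
  exists2 T, symmetric_tensor T & g = cubic_of_tensor T.
Proof.
move=> nz6 /dhomogP hg; rewrite (mpolyE g).
have : {subset msupp g <= [pred m : 'X_{1..n} | mdeg m == 3]}.
  by move=> m /hg /= /eqP.
elim: (msupp g) => [|m s IH] hs.
  exists (fun _ _ _ => 0) => //.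
  by rewrite big_nil /cubic_of_tensor !big1 // => i _; rewrite big1 // => j _;
    rewrite big1 // => k _; rewrite scale0r.
have [|T sT ET] := IH; first by move=> x xs; apply: hs; rewrite inE xs orbT.
have /= /eqP dm := hs m (mem_head _ _).
have [a [b [c Em]]] : exists a b c : 'I_n, m = (U_(a) + U_(b) + U_(c))%MM.
  have pick q (x : 'X_{1..n}) : mdeg x = q.+1 ->
      exists2 i : 'I_n, x = (U_(i) + (x - U_(i)))%MM & mdeg (x - U_(i))%MM = q.
    move=> dx; have /existsP[i xi] : [exists i : 'I_n, x i != 0%N].
      apply/existsPn => x0; suff: mdeg x = 0%N by rewrite dx.
      by rewrite mdegE big1 // => i _; apply/eqP; rewrite -[_ == _]negbK x0.
    have Ei : x = (U_(i) + (x - U_(i)))%MM.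
      apply/mnmP => j; rewrite mnmDE mnmBE mnm1E subnKC //.
      by case: eqP => // <-; rewrite lt0n.
    by exists i => //; apply/eqP; rewrite -eqSS -dx {2}Ei mdegD mdeg1.
  have [a Ea da] := pick 2 _ dm; have [b Eb db] := pick 1%N _ da.
  have [c Ec dc] := pick 0%N _ db.
  have /eqP := dc; rewrite mdeg_eq0 => /eqP z.
  exists a, b, c; rewrite Ea Eb Ec z addm0 addmA //.
pose D (u v w i j k : 'I_n) := d u i * d v j * d w k.
pose P i j k := D a b c i j k + D a c b i j k + D b a c i j k
              + D b c a i j k + D c a b i j k + D c b a i j k.
exists (fun i j k => g@_m / 6%:R * P i j k + T i j k).
  move=> i j k; have [e1 e2] := sT i j k.
  by split; [rewrite -e1|rewrite -e2]; rewrite /P /D; ring.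
rewrite big_cons ET.
have sumX u v w : cubic_of_tensor (D u v w) = 'X_u * 'X_v * 'X_w.
  have sum_dX (F : 'I_n -> {mpoly K[n]}) x : \sum_(i < n) d x i *: F i = F x.
    rewrite (bigD1 x) //= /d eqxx scale1r big1 ?addr0 // => i.
    by rewrite eq_sym => /negPf->; rewrite scale0r.
  rewrite -[RHS](sum_dX (fun i => 'X_i * 'X_v * 'X_w) u).
  apply: eq_bigr => i _.
  rewrite -(sum_dX (fun j => 'X_i * 'X_j * 'X_w) v) scaler_sumr.
  apply: eq_bigr => j _.
  rewrite -(sum_dX (fun k => 'X_i * 'X_j * 'X_k) w) !scaler_sumr.
  by apply: eq_bigr => k _; rewrite !scalerA.
have cD (U V : 'I_n -> 'I_n -> 'I_n -> K) : cubic_of_tensor (fun i j k => U i j k + V i j k) =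
    cubic_of_tensor U + cubic_of_tensor V.
  pose W T i j k : {mpoly K[n]} := T i j k *: ('X_i * 'X_j * 'X_k).
  rewrite -[RHS](sum3D (W U) (W V)); apply: eq_bigr => i _; apply: eq_bigr => j _.
  by apply: eq_bigr => k _; rewrite /W scalerDl.
have cZ (x : K) (U : 'I_n -> 'I_n -> 'I_n -> K) : cubic_of_tensor (fun i j k => x * U i j k) =
    x *: cubic_of_tensor U.
  rewrite /cubic_of_tensor scaler_sumr; apply: eq_bigr => i _.
  rewrite scaler_sumr; apply: eq_bigr => j _.
  by rewrite scaler_sumr; apply: eq_bigr => k _; rewrite scalerA.
rewrite cD; congr (_ + _); rewrite cZ /P !cD !sumX.
have -> : 'X_[m] = 'X_a * 'X_b * 'X_c :> {mpoly K[n]} by rewrite Em !mpolyXD.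
rewrite -scalerA -[in LHS](scale1r (_ * _ * _)) -[in LHS](mulVf nz6) -scalerA.
congr (_ *: (_ *: _)); rewrite scaler_nat; ring.
Qed.

Lemma tensorP g : 6%:R != 0 :> K -> g \is 3.-homog ->
  symmetric_tensor (tensor g) /\ g = cubic_of_tensor (tensor g).
Proof.
move=> nz6 hg; have [T sT gT] := tensor_exists nz6 hg.
exact: (@xgetPex _ _ (fun T => symmetric_tensor T /\ g = cubic_of_tensor T)
  (ex_intro _ T (conj sT gT))).
Qed.

End TensorWellDefined.

(* Main.v *)
Require Import Defs.
From HB Require Import structures.
From mathcomp Require Import all_boot all_order all_algebra.
From mathcomp Require Import finmap boolp reals complex.
From mathcomp Require Import mpoly ring lra.

Set Implicit Arguments.
Unset Strict Implicit.
Unset Printing Implicit Defensive.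

Import Order.TTheory GRing.Theory Num.Theory.
Local Open Scope ring_scope.

(* Let A(u) be the sum of the u_k T_k, where T_k are the slices of f. The k-th
   slice of f(Mx) is M^T A(m_k) M with m_k the k-th column of M, so the run on M
   depends, up to conjugation by M, only on B(u) = A(m_1)^-1 A(u) at m_2 and
   m_3. If all B(u) commute and are diagonalizable, a common eigenbasis turns f
   into a combination of cubes of the coordinates, whose coefficients have cube
   roots. Otherwise the u such that B(u) is diagonalizable and commutes with all
   B(w) form a proper subspace; and when B(u) does not commute with all B(w), the
   w for which it does form a proper subspace too. A random column hits a proper
   subspace with probability at most 1/|S|, hence 2/|S| in total. Conversely, for
   f = P_3(Ax) the run accepts as soon as M is invertible and the n entries of
   A m_1 are nonzero; failure is covered by 2n events of probability at most
   1/|S|. *)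

(** * The trilinear form of a cubic and linear substitutions *)

Section Contraction.
Variables (K : fieldType) (n : nat).
Implicit Types (T : 'I_n -> 'I_n -> 'I_n -> K) (M : 'M[K]_n) (u w : 'cV[K]_n).

(** For symmetric [T] this is one sixth of the Hessian of [cubic_of_tensor T] at [u]. *)
Definition contract T u : 'M[K]_n := \matrix_(i, j) \sum_k T i j k * u k 0.

Definition tensor_subst T M a b c : K :=
  \sum_i \sum_j \sum_k T i j k * (M i a * M j b * M k c).

Lemma contractP T a u w :
  contract T (a *: u + w) = a *: contract T u + contract T w.
Proof.
apply/matrixP => i j; rewrite !mxE mulr_sumr -big_split /=.
by apply: eq_bigr => k _; rewrite !mxE; ring.
Qed.

Lemma contract_delta T i j k : contract T (delta_mx k 0) i j = T i j k.
Proof.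
rewrite mxE (bigD1 k) //= mxE !eqxx mulr1 big1 ?addr0 // => l /negPf lk.
by rewrite mxE lk mulr0.
Qed.

(** Both sides evaluate two arguments of the trilinear form at [u] and [w]. *)
Lemma contractC T u w : symmetric_tensor T ->
  contract T u *m w = contract T w *m u.
Proof.
move=> sT; apply/colP => i; rewrite !mxE.
under eq_bigr do rewrite !mxE mulr_suml.
under [RHS]eq_bigr do rewrite !mxE mulr_suml.
rewrite exchange_big /=; apply: eq_bigr => j _; apply: eq_bigr => k _.
by rewrite (sT i k j).2; ring.
Qed.

Lemma contract_sym T u : symmetric_tensor T -> (contract T u)^T = contract T u.
Proof.
move=> sT; apply/matrixP => i j; rewrite !mxE.
by apply: eq_bigr => k _; rewrite (sT j i k).1.
Qed.

(** Chain rule for the Hessian: a substitution acts by congruence. *)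
Lemma contract_tensor_subst T M u :
  contract (tensor_subst T M) u = M^T *m contract T (M *m u) *m M.
Proof.
apply/matrixP => a b; rewrite !mxE.
under [RHS]eq_bigr do rewrite !mxE mulr_suml.
rewrite exchange_big /=.
under eq_bigr do rewrite mulr_suml.
rewrite exchange_big /=; apply: eq_bigr => i _.
under eq_bigr do rewrite mulr_suml.
rewrite exchange_big /=; apply: eq_bigr => j _.
under eq_bigr do rewrite mulr_suml.
rewrite !mxE mulr_sumr mulr_suml exchange_big /=; apply: eq_bigr => k _.
rewrite !mxE !mulr_sumr mulr_suml; apply: eq_bigr => c _; ring.
Qed.

Lemma tensor_subst_sym T M :
  symmetric_tensor T -> symmetric_tensor (tensor_subst T M).
Proof.
move=> sT a b c; split; rewrite /tensor_subst.
  rewrite exchange_big /=; do 3!apply: eq_bigr => ? _.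
  by rewrite (sT _ _ _).1; ring.
apply: eq_bigr => i _; rewrite exchange_big /=; do 2!apply: eq_bigr => ? _.
by rewrite (sT _ _ _).2; ring.
Qed.

Lemma cubic_of_tensor_sum I (r : seq I) (c : I -> K)
    (F : I -> 'I_n -> 'I_n -> 'I_n -> K) :
  cubic_of_tensor (fun i j k => \sum_(x <- r) c x * F x i j k) =
  \sum_(x <- r) c x *: cubic_of_tensor (F x).
Proof.
rewrite /cubic_of_tensor.
under [RHS]eq_bigr do rewrite scaler_sumr.
rewrite [RHS]exchange_big /=; apply: eq_bigr => i _.
under [RHS]eq_bigr do rewrite scaler_sumr.
rewrite [RHS]exchange_big /=; apply: eq_bigr => j _.
under [RHS]eq_bigr do rewrite scaler_sumr.
rewrite [RHS]exchange_big /=; apply: eq_bigr => k _.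
by rewrite scaler_suml; apply: eq_bigr => x _; rewrite scalerA.
Qed.

Let linform (M : 'M[K]_n) i : {mpoly K[n]} := \sum_j M i j *: 'X_j.

Let linform3 M i j k :
  linform M i * linform M j * linform M k =
  cubic_of_tensor (fun a b c => M i a * M j b * M k c).
Proof.
rewrite /linform -mulrA mulr_suml; apply: eq_bigr => a _.
rewrite mulr_suml mulr_sumr; apply: eq_bigr => b _.
rewrite !mulr_sumr; apply: eq_bigr => c _.
by rewrite -!scalerAl -!scalerAr !scalerA !mulrA.
Qed.

Let lin_substX M i : lin_subst 'X_i M = linform M i.
Proof. by rewrite /lin_subst comp_mpolyXU -tnth_nth tnth_mktuple. Qed.

Lemma lin_subst_cubic T M :
  lin_subst (cubic_of_tensor T) M = cubic_of_tensor (tensor_subst T M).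
Proof.
rewrite /lin_subst raddf_sum /=.
transitivity (\sum_i \sum_j \sum_k
    T i j k *: (linform M i * linform M j * linform M k)).
  apply: eq_bigr => i _; rewrite raddf_sum; apply: eq_bigr => j _ /=.
  rewrite raddf_sum; apply: eq_bigr => k _ /=.
  by rewrite comp_mpolyZ !rmorphM /= -!lin_substX.
(* The factors 1 give the sums the weighted form of [cubic_of_tensor_sum]. *)
transitivity (\sum_i 1 *: cubic_of_tensor (fun a b c =>
   \sum_j 1 * \sum_k T i j k * (M i a * M j b * M k c))).
  apply: eq_bigr => i _; rewrite scale1r cubic_of_tensor_sum.
  apply: eq_bigr => j _; rewrite scale1r cubic_of_tensor_sum.
  by apply: eq_bigr => k _; rewrite linform3.
rewrite -cubic_of_tensor_sum; congr cubic_of_tensor.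
apply/funext => a; apply/funext => b; apply/funext => c.
by apply: eq_bigr => i _; rewrite mul1r; apply: eq_bigr => j _; rewrite mul1r.
Qed.

Definition cubes_tensor M a b c : K := \sum_i M i a * M i b * M i c.

Lemma lin_subst_P3 M : lin_subst (P3 K n) M = cubic_of_tensor (cubes_tensor M).
Proof.
rewrite /lin_subst raddf_sum /=.
transitivity (\sum_i 1 *: cubic_of_tensor (fun a b c => M i a * M i b * M i c)).
  apply: eq_bigr => i _.
  by rewrite scale1r -linform3 -!lin_substX rmorphXn /= exprS expr2 mulrA.
rewrite -cubic_of_tensor_sum; congr cubic_of_tensor.
apply/funext => a; apply/funext => b; apply/funext => c.
by apply: eq_bigr => i _; rewrite mul1r.
Qed.

Lemma cubes_tensor_sym M : symmetric_tensor (cubes_tensor M).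
Proof. by move=> a b c; split; apply: eq_bigr => i _; ring. Qed.

Lemma contract_cubes_tensor M u :
  contract (cubes_tensor M) u = M^T *m diag_mx (M *m u)^T *m M.
Proof.
apply/matrixP => a b; rewrite mul_mx_diag !mxE.
under eq_bigr do rewrite mulr_suml.
rewrite exchange_big; apply: eq_bigr => i _ /=.
by rewrite !mxE !mulr_sumr mulr_suml; apply: eq_bigr => c _; ring.
Qed.

(** [slice] goes through a chosen tensor; as 6 is invertible, uniqueness identifies it with [T]. *)
Lemma slice_cubic T c : 6%:R != 0 :> K -> symmetric_tensor T ->
  slice (cubic_of_tensor T) c = contract T (delta_mx c 0).
Proof.
move=> nz6 sT; pose Q U :=
  symmetric_tensor U /\ cubic_of_tensor T = cubic_of_tensor U.
have [sU EU] : Q (tensor (cubic_of_tensor T)).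
  exact: (classical_sets.xgetPex _ (ex_intro Q T (conj sT erefl))).
apply/matrixP => a b; rewrite contract_delta mxE.
by rewrite -(tensor_unique nz6 sT erefl sU EU).
Qed.

Lemma slice_lin_subst T M c : 6%:R != 0 :> K -> symmetric_tensor T ->
  slice (lin_subst (cubic_of_tensor T) M) c =
  M^T *m contract T (col c M) *m M.
Proof.
move=> nz6 sT; rewrite lin_subst_cubic slice_cubic //; last first.
  exact: tensor_subst_sym.
by rewrite contract_tensor_subst colE.
Qed.

End Contraction.

(** * Commuting diagonalizable pencils give sums of cubes *)

Section Diagonalization.
Variables (K : fieldType) (n : nat).
Implicit Types (T : 'I_n -> 'I_n -> 'I_n -> K) (A B P : 'M[K]_n).
Implicit Types (u v w : 'cV[K]_n).

Lemma invmx_mul A B : A \in unitmx -> B \in unitmx ->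
  invmx (A *m B) = invmx B *m invmx A.
Proof.
move=> uA uB; have uAB : A *m B \in unitmx by rewrite unitmx_mul uA.
by apply: (can_inj (mulKmx uAB)); rewrite mulmxV // !mulmxA mulmxK // mulmxV.
Qed.

Lemma diagonalizable_conj A B P : P \in unitmx ->
  diagonalizable A -> B = invmx P *m A *m P -> diagonalizable B.
Proof.
move=> uP [Q uQ dQ] ->; exists (Q *m P); first by rewrite unitmx_mul uQ.
rewrite /similar_to conjumx // in dQ.
rewrite /similar_to conjumx ?unitmx_mul ?uQ //.
by rewrite invmx_mul // !mulmxA !mulmxK.
Qed.

(** A common eigenbasis of [A] and [B] diagonalizes every combination. *)
Lemma diagonalizable_lin A B (a : K) : comm_mx A B ->
  diagonalizable A -> diagonalizable B -> diagonalizable (a *: A + B).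
Proof.
move=> cAB dA dB.
have [P uP /allP dP] : codiagonalizable [:: A; B].
  apply/codiagonalizableP; split.
    move=> X Y; rewrite !inE => /orP[]/eqP-> /orP[]/eqP-> //.
  by move=> X; rewrite !inE => /orP[]/eqP->.
have dPA : is_diag_mx (conjmx P A) by apply: dP; rewrite !inE eqxx.
have dPB : is_diag_mx (conjmx P B) by apply: dP; rewrite !inE eqxx orbT.
exists P => //; apply/is_diag_mxP => i j ij.
rewrite conjumx // in dPA; rewrite conjumx // in dPB; rewrite conjumx //.
rewrite mulmxDr mulmxDl -scalemxAr -scalemxAl mxE [X in X + _]mxE.
by rewrite (is_diag_mxP dPA _ _ ij) (is_diag_mxP dPB _ _ ij) mulr0 addr0.
Qed.

(* In a basis diagonalizing all the pencils, the form [contract T v] commutes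
   with the independent diagonal matrices [P B(u) P^-1], hence is diagonal; by
   symmetry the whole tensor is then supported on its diagonal. *)
Lemma codiagonalizable_equiv_sum_of_cubes T v :
  (forall c : K, exists x, x ^+ 3 = c) -> symmetric_tensor T ->
  contract T v \in unitmx ->
  (forall u w, comm_mx (invmx (contract T v) *m contract T u)
                       (invmx (contract T v) *m contract T w)) ->
  (forall u, diagonalizable (invmx (contract T v) *m contract T u)) ->
  equiv_sum_of_cubes (cubic_of_tensor T).
Proof.
move=> cbrt sT uA; set B := fun u => invmx (contract T v) *m contract T u.
move=> cB dB.
(* The eigenbasis is taken for the finitely many [B (delta_mx k 0)]; linearity extends it to every
   [B u]. *)
have [P uP /allP dP] : codiagonalizable [seq B (delta_mx k 0) | k <- enum 'I_n].
  apply/codiagonalizableP; split.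
    by move=> _ _ /mapP[k _ ->] /mapP[l _ ->]; exact: cB.
  by move=> _ /mapP[k _ ->]; exact: dB.
pose Q := invmx P.
have uQ : Q \in unitmx by rewrite unitmx_inv.
have diagB u i j : i != j -> (P *m B u *m Q) i j = 0.
  move=> ij.
  have -> : B u = \sum_k u k 0 *: B (delta_mx k 0).
    have -> : B u = invmx (contract T v) *m
        \sum_k u k 0 *: contract T (delta_mx k 0).
      congr (_ *m _); apply/matrixP => a b; rewrite summxE mxE.
      by apply: eq_bigr => k _; rewrite mxE contract_delta mulrC.
    by rewrite mulmx_sumr; apply: eq_bigr => k _; rewrite -scalemxAr.
  rewrite mulmx_sumr mulmx_suml summxE big1 // => k _.
  rewrite -scalemxAr -scalemxAl mxE.
  have /dP : B (delta_mx k 0) \in [seq B (delta_mx k 0) | k <- enum 'I_n].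
    by apply: map_f; rewrite mem_enum.
  rewrite /= /similar_to conjumx // => /is_diag_mxP/(_ i j ij) ->.
  by rewrite mulr0.
(* The tensor of the cubic in the coordinates y = P x. *)
pose t := tensor_subst T Q.
have st : symmetric_tensor t by exact: tensor_subst_sym.
pose G := contract t (P *m v).
have GE : G = Q^T *m contract T v *m Q.
  by rewrite /G contract_tensor_subst mulmxA mulVmx // mul1mx.
have uG : G \in unitmx by rewrite GE !unitmx_mul unitmx_tr uQ uA.
have symG : G^T = G by exact: contract_sym.
(* [E k j] is the [j]-th eigenvalue of [B] at the [k]-th column of [Q]. *)
pose E : 'M[K]_n := \matrix_(k, j) (P *m B (Q *m delta_mx k 0) *m Q) j j.
have tE i j k : t i j k = G i j * E k j.
  rewrite -contract_delta contract_tensor_subst.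
  have -> : Q^T *m contract T (Q *m delta_mx k 0) *m Q =
            G *m (P *m B (Q *m delta_mx k 0) *m Q).
    rewrite GE !mulmxA; congr (_ *m _).
    by rewrite mulmxKV // mulmxK.
  rewrite mxE (bigD1 j) //= big1 ?addr0 ?mxE //.
  by move=> l lj; rewrite diagB // mulr0.
clearbody E.
(* If [x *m E = 0], then [contract t x^T] vanishes, so [G *m x^T = 0] by symmetry, and [G] is
   invertible. *)
have uE : E \in unitmx.
  rewrite -row_free_unit; apply: inj_row_free => x xE.
  have ct0 : contract t x^T = 0.
    apply/matrixP => i j; rewrite !mxE.
    transitivity (G i j * (x *m E) 0 j); last first.
      by rewrite xE [X in _ * X]mxE mulr0.
    rewrite [X in _ * X]mxE mulr_sumr; apply: eq_bigr => k _.
    by rewrite tE [x^T _ _]mxE -mulrA [E _ _ * _]mulrC.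
  have Gx0 : G *m x^T = 0 by rewrite contractC // ct0 mul0mx.
  by apply: trmx_inj; rewrite -[x^T](mulKmx uG) Gx0 mulmx0 trmx0.
(* If [G i j] is nonzero, exchanging [i] and [j] in [t i j k] gives [E] two equal columns. *)
have G0 i j : i != j -> G i j = 0.
  move=> ij; apply/eqP/negPn/negP => Gij.
  have Eij k : E k i = E k j.
    apply: (mulfI Gij); rewrite -[RHS]tE (st i j k).1 tE.
    by rewrite -[in LHS]symG mxE.
  have : E *m (delta_mx i 0 - delta_mx j 0 : 'cV_n) = 0.
    by rewrite mulmxBr -!colE; apply/colP => k; rewrite !mxE Eij subrr.
  move=> /(congr1 (mulmx (invmx E))); rewrite mulKmx // mulmx0.
  move=> /colP/(_ i); rewrite !mxE !eqxx (negPf ij) subr0.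
  by move/eqP; rewrite oner_eq0.
have t0 i j k : ~~ ((i == j) && (i == k)) -> t i j k = 0.
  rewrite negb_and => /orP[ij|ik]; first by rewrite tE G0 // mul0r.
  by rewrite (st i j k).2 tE G0 // mul0r.
have ctE u : contract t u = diag_mx (\row_i (t i i i * u i 0)).
  apply/matrixP => i j; rewrite !mxE.
  have [<-|ij] := eqVneq i j; last first.
    by rewrite big1 // => k _; rewrite t0 ?mul0r // (negPf ij).
  rewrite (bigD1 i) //= big1 ?addr0 // => k ki.
  by rewrite t0 ?mul0r // eqxx eq_sym (negPf ki).
have nzt i : t i i i != 0.
  apply/negP => /eqP ti0.
  have : delta_mx 0 i *m G = 0 :> 'rV_n.
    rewrite /G ctE -rowE; apply/rowP => j.
    by rewrite !mxE ti0 mul0r mul0rn.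
  move=> /(congr1 (mulmx^~ (invmx G))); rewrite mulmxK // mul0mx.
  by move=> /rowP/(_ i)/eqP; rewrite !mxE !eqxx oner_eq0.
have /choice[a aE] i : exists x, x ^+ 3 = t i i i by exact: cbrt.
(* The cubic is now the sum of [t i i i] y_i^3; rescaling y_i by a cube root of [t i i i] absorbs
   the coefficient. *)
exists (diag_mx (\row_i a i) *m P).
  rewrite unitmx_mul uP andbT unitmxE det_diag unitfE.
  apply/prodf_neq0 => i _; rewrite mxE; apply: contraNneq (nzt i) => ai0.
  by rewrite -aE ai0 expr0n.
rewrite lin_subst_P3; congr cubic_of_tensor.
apply/funext => x; apply/funext => y; apply/funext => z.
have TE u : contract T u = P^T *m contract t (P *m u) *m P.
  rewrite contract_tensor_subst (mulmxA Q) mulVmx // mul1mx !mulmxA.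
  by rewrite mulmxKV // -trmx_mul mulVmx // trmx1 mul1mx.
rewrite -contract_delta TE ctE mul_mx_diag !mxE; apply: eq_bigr => i _.
by rewrite -colE !mul_diag_mx !mxE -aE; ring.
Qed.

End Diagonalization.

(** * Probability bounds for a random matrix *)

Section RandomMatrix.
Variables (K : fieldType) (n : nat) (S : {fset K}).
Implicit Types (E : pred 'M[K]_n) (M : 'M[K]_n) (u w : 'cV[K]_n).

(** Varying [u] with [M] fixed amounts to conditioning on all columns but the [k]-th. *)
Definition set_col (k : 'I_n) M u : 'M[K]_n :=
  \matrix_(i, j) if j == k then u i 0 else M i j.

Lemma col_set_col k M u j :
  col j (set_col k M u) = if j == k then u else col j M.
Proof. by apply/colP => i; rewrite !mxE; case: ifP => // _; rewrite mxE. Qed.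

Lemma set_col_id k M : set_col k M (col k M) = M.
Proof. by apply/matrixP => i j; rewrite !mxE; case: eqP => // ->. Qed.

Lemma set_col_eq k M M' :
  (forall i j, j != k -> M i j = M' i j) -> set_col k M = set_col k M'.
Proof.
move=> MM'; apply/funext => u; apply/matrixP => i j; rewrite !mxE.
by case: eqVneq => // /MM'.
Qed.

Let card_event E := #|[pred r : 'M[S]_n | E (map_mx val r)]|.

Let prob_entriesE E :
  prob_entries S E = (card_event E)%:R / (#|` S| ^ (n * n))%:R.
Proof.
rewrite /prob_entries sumr_const -[LHS]mulr_natl; congr (_ * _).
by rewrite !prodr_const card_ord -exprM natrX exprVn.
Qed.

Lemma prob_entries_union (I : finType) (F : I -> pred 'M[K]_n) E p :
  (forall M, E M -> exists i, F i M) ->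
  (forall i, prob_entries S (F i) <= p) -> prob_entries S E <= p *+ #|I|.
Proof.
move=> sE leF; apply: le_trans (_ : \sum_i prob_entries S (F i) <= _); last first.
  have -> : p *+ #|I| = \sum_(i : I) p by rewrite sumr_const.
  exact: ler_sum.
rewrite /prob_entries big_mkcond /=.
under [leRHS]eq_bigr do rewrite big_mkcond /=.
rewrite [leRHS]exchange_big; apply: ler_sum => r _ /=.
set c := \prod_(i < n) _.
have c0 : 0 <= c.
  by do 2!apply: prodr_ge0 => ? _; rewrite invr_ge0 ler0n.
have sum0 (P : pred I) : 0 <= \sum_(i | P i) if F i (map_mx val r) then c else 0.
  by apply: sumr_ge0 => i _; case: ifP.
by case: ifP => // /sE[i Fi]; rewrite (bigD1 i) //= Fi lerDl.
Qed.

Lemma prob_entries_predC E : S != fset0 ->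
  prob_entries S (predC E) = 1 - prob_entries S E.
Proof.
move=> S0; have nz : (#|` S| ^ (n * n))%:R != 0 :> rat.
  by rewrite pnatr_eq0 expn_eq0 cardfs_eq0 (negPf S0).
apply/eqP; rewrite eq_sym subr_eq addrC !prob_entriesE -mulrDl -natrD.
by rewrite /card_event cardC card_mx -cardfE divff.
Qed.

(* The vectors [u] with [E (set_col k M u)] form a proper subspace, so they
   miss some basis vector [e_i]: two entries at [(i, k)] cannot both realize
   [E], so overwriting this entry embeds [E * S] into the set of matrices. *)
Lemma prob_entries_col_subspace E k :
  (forall M a u w, E (set_col k M u) -> E (set_col k M w) ->
     E (set_col k M (a *: u + w))) ->
  (forall M, exists u, ~~ E (set_col k M u)) ->
  prob_entries S E <= #|` S|%:R^-1.
Proof.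
move=> linE propE.
have miss M : E M -> exists i, ~~ E (set_col k M (delta_mx i 0)).
  move=> EM; have [u Eu] := propE M; apply/existsP; apply: contraNT Eu.
  move=> /existsPn all_e; rewrite (matrix_sum_delta u).
  (* Zero is column [k] of [M], which satisfies [E], minus itself. *)
  have E0 : E (set_col k M 0).
    by rewrite -(subrr (col k M)) addrC -scaleN1r linE // set_col_id.
  elim/big_rec: _ => // i x _ Ex; rewrite big_ord1 linE //.
  by have := all_e i; rewrite negbK.
(* [ix] ignores column [k], so it can still be read off after an entry of that column is
   overwritten. *)
pose ix M := [pick i | ~~ E (set_col k M (delta_mx i 0))].
have ix_eq M M' : (forall i j, j != k -> M i j = M' i j) -> ix M = ix M'.
  by move=> MM'; rewrite /ix (set_col_eq MM').
pose put (i : 'I_n) (p : 'M[S]_n * S) : 'M[S]_n :=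
  \matrix_(a, b) if (a == i) && (b == k) then p.2 else p.1 a b.
(* By [miss], the default [p.1] does not occur when [E] holds for the matrix. *)
pose phi (p : 'M[S]_n * S) :=
  if ix (map_mx val p.1) is Some i then put i p else p.1.
have ix_phi p : ix (map_mx val (phi p)) = ix (map_mx val p.1).
  apply: ix_eq => i j jk; rewrite /phi; case: (ix _) => [l|] //.
  by rewrite !mxE (negPf jk) andbF.
pose A := [set p : 'M[S]_n * S | E (map_mx val p.1)].
have phi_inj : {in A &, injective phi}.
  move=> [r s] [r' s']; rewrite !inE /= => Er Er' eq_phi.
  have := ix_phi (r, s); rewrite eq_phi ix_phi /= => eq_ix.
  move: eq_phi; rewrite /phi /= -eq_ix /ix.
  case: pickP => [i Ei|all_e]; last first.
    by have [j] := miss _ Er'; rewrite all_e.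
  rewrite /put /= => /matrixP eq_put.
  have ss' : s = s' by have := eq_put i k; rewrite !mxE !eqxx.
  have rr' a b : ~~ ((a == i) && (b == k)) -> r a b = r' a b.
    by move=> /negPf ab; have := eq_put a b; rewrite !mxE ab.
  rewrite -ss'; congr (_, _); apply/matrixP => a b.
  have [/andP[/eqP-> /eqP->]|] := boolP ((a == i) && (b == k)); last exact: rr'.
  apply/val_inj/eqP; rewrite -subr_eq0; apply: contraNT Ei => nz.
  set x := _ - _ in nz.
  have eq_sc : set_col k (map_mx val r') = set_col k (map_mx val r).
    by apply: set_col_eq => a' b' b'k; rewrite !mxE rr' // (negPf b'k) andbF.
  (* The two columns differ only in row [i], by [x]; their rescaled difference is the basis vector
     that [ix] chose outside [E]. *)
  rewrite eq_sc; have -> : delta_mx i 0 =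
      x^-1 *: (col k (map_mx val r) - col k (map_mx val r')) + 0 :> 'cV_n.
    rewrite addr0; apply/colP => a'; rewrite !mxE.
    have [->|ai] := eqVneq a' i; first by rewrite mulVf.
    by rewrite rr' ?(negPf ai) // subrr mulr0.
  have Ec : E (set_col k (map_mx val r) (col k (map_mx val r))).
    by rewrite set_col_id.
  have Ec' : E (set_col k (map_mx val r) (col k (map_mx val r'))).
    by rewrite -eq_sc set_col_id.
  apply: (linE); first by rewrite addrC -scaleN1r linE.
  by rewrite -(subrr (col k (map_mx val r))) addrC -scaleN1r linE.
have le_card : (card_event E * #|` S| <= #|` S| ^ (n * n))%N.
  rewrite cardfE -card_mx .
  have <- : #|A| = (card_event E * #|{: S}|)%N.
    rewrite /card_event -cardX; apply: eq_card => -[r s].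
    by rewrite !inE andbT.
  by rewrite -(card_in_imset phi_inj) max_card.
rewrite prob_entriesE.
(* For empty [S] both sides are 0, the inverse of 0 being 0. *)
have [->|S0] := posnP #|` S|.
  have n0 : (0 < n)%N := leq_ltn_trans (leq0n k) (ltn_ord k).
  by rewrite exp0n ?muln_gt0 ?n0 // invr0 mulr0.
rewrite ler_pdivrMr ?ltr0n ?expn_gt0 ?S0 //.
by rewrite mulrC ler_pdivlMr ?ltr0n // -natrM ler_nat.
Qed.

Let hybrid (k : nat) M : 'M[K]_n :=
  \matrix_(i, j) if (j < k)%N then M i j else (i == j)%:R.

(** The cofactors along column [k] ignore that column, so the determinant is linear in [u]. *)
Let det_set_col k M u :
  \det (set_col k M u) = \sum_i u i 0 * cofactor M i k.
Proof.
rewrite (expand_det_col _ k); apply: eq_bigr => i _.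
rewrite mxE eqxx /cofactor; congr (_ * (_ * \det _)).
by apply/matrixP => a b; rewrite !mxE eq_sym (negPf (neq_lift _ _)).
Qed.

(* If [M] is singular, then [k] exists such that replacing the columns [>= k]
   of [M] by those of the identity gives a nonsingular matrix, but replacing
   only the columns [> k] does not; the failure is linear in column [k]. *)
Lemma singular_col_subspaces : exists F : 'I_n -> pred 'M[K]_n,
  (forall M, M \notin unitmx -> exists k, F k M) /\
  (forall k, prob_entries S (F k) <= #|` S|%:R^-1).
Proof.
exists (fun k M => (\det (hybrid k M) != 0) && (\det (hybrid k.+1 M) == 0)).
split=> [M sM|k].
  apply/existsP; apply: contraNT sM => /existsPn noF.
  have nz k : (k <= n)%N -> \det (hybrid k M) != 0.
    elim: k => [_|k IH kn].
      have -> : hybrid 0 M = 1%:M by apply/matrixP => i j; rewrite !mxE.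
      by rewrite det1 oner_eq0.
    by have := noF (Ordinal kn); rewrite IH ?(ltnW kn).
  have <- : hybrid n M = M by apply/matrixP => i j; rewrite mxE ltn_ord.
  by rewrite unitmxE unitfE nz.
have hk M u : hybrid k (set_col k M u) = hybrid k M.
  apply/matrixP => i j; rewrite !mxE; case: ltnP => // jk.
  by case: eqP jk => // ->; rewrite ltnn.
have hkS M u : hybrid k.+1 (set_col k M u) = set_col k (hybrid k M) u.
  apply/matrixP => i j; rewrite !mxE ltnS leq_eqVlt.
  by rewrite (inj_eq val_inj); case: eqP.
apply: (prob_entries_col_subspace (k := k)) => [M a u w|M].
  rewrite !hk !hkS !det_set_col => /andP[-> /eqP u0] /andP[_ /eqP w0] /=.
  apply/eqP; transitivity (a * \sum_i u i 0 * cofactor (hybrid k M) i k +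
      \sum_i w i 0 * cofactor (hybrid k M) i k); last first.
    by rewrite u0 w0 mulr0 addr0.
  rewrite mulr_sumr -big_split /=; apply: eq_bigr => i _.
  by rewrite !mxE mulrDl mulrA.
(* This column turns [hybrid k.+1] back into [hybrid k], so the two conditions contradict each
   other. *)
exists (col k (hybrid k M)); rewrite hk hkS set_col_id negb_and negbK.
exact: orbN.
Qed.

End RandomMatrix.

(** * Acceptance in terms of pencils, and the two error bounds *)

Section Algorithm.
Variables (K : fieldType) (n : nat) (n_ge3 : (3 <= n)%N) (S : {fset K}).
Hypothesis nz6 : 6%:R != 0 :> K.
Implicit Types (T : 'I_n -> 'I_n -> 'I_n -> K) (M : 'M[K]_n).
Implicit Types (u v w : 'cV[K]_n).

Let k1 : 'I_n := widen_ord n_ge3 (@Ordinal 3 0 isT).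
Let k2 : 'I_n := widen_ord n_ge3 (@Ordinal 3 1 isT).
Let k3 : 'I_n := widen_ord n_ge3 (@Ordinal 3 2 isT).

(** The matrix B(u) of the overview, with [v] in the role of m_1. *)
Definition pencil T v u : 'M[K]_n := invmx (contract T v) *m contract T u.

Lemma pencilP T v a u w :
  pencil T v (a *: u + w) = a *: pencil T v u + pencil T v w.
Proof. by rewrite /pencil contractP mulmxDr -scalemxAr. Qed.

Lemma acceptsP T M : symmetric_tensor T ->
  accepts n_ge3 (cubic_of_tensor T) M <->
  [/\ M \in unitmx, contract T (col k1 M) \in unitmx,
      comm_mx (pencil T (col k1 M) (col k2 M)) (pencil T (col k1 M) (col k3 M))
    & diagonalizable (pencil T (col k1 M) (col k2 M))].
Proof.
move=> sT; rewrite /accepts !slice_lin_subst // -/k1 -/k2 -/k3.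
rewrite !unitmx_mul unitmx_tr.
have [uM|] := boolP (M \in unitmx); last by split=> // -[].
have [uC|] := boolP (contract T (col k1 M) \in unitmx); last by split=> // -[].
(* The factors [M^T] cancel, so congruence of slices becomes conjugation of pencils. *)
have conjE k : invmx (M^T *m contract T (col k1 M) *m M) *m
    (M^T *m contract T (col k M) *m M) =
    invmx M *m pencil T (col k1 M) (col k M) *m M.
  have uMt : M^T \in unitmx by rewrite unitmx_tr.
  rewrite !invmx_mul ?unitmx_mul ?uMt // /pencil !mulmxA.
  by rewrite mulmxKV.
rewrite /= !conjE; set B2 := pencil _ _ _; set B3 := pencil _ _ _.
clearbody B2 B3.
have mulC X Y : invmx M *m X *m M *m (invmx M *m Y *m M) =
    invmx M *m (X *m Y) *m M by rewrite !mulmxA mulmxK.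
split=> [/andP[/eqP cB /asboolP dB]|[_ _ cB dB]].
  split=> //.
    move: cB; rewrite !mulC => /(congr1 (fun X => M *m X *m invmx M)).
    by rewrite /= !mulmxA !mulmxV // !mul1mx !mulmxK.
  apply: (diagonalizable_conj (P := invmx M) _ dB); rewrite ?unitmx_inv //.
  by rewrite invmxK !mulmxA mulmxV // mul1mx mulmxK.
apply/andP; split; first by apply/eqP; rewrite !mulC cB.
by apply/asboolP; exact: (diagonalizable_conj uM dB).
Qed.

Lemma prob_accepts_le f : (forall c : K, exists x, x ^+ 3 = c) ->
  f \is 3.-homog -> ~ equiv_sum_of_cubes f ->
  prob_entries S (accepts n_ge3 f) <= 2%:R / #|` S|%:R.
Proof.
move=> cbrt /(tensorP nz6)[sT ->]; set T := tensor f => not_cubes.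
pose central v u := forall w, comm_mx (pencil T v u) (pencil T v w).
(* An accepting run lies in [E2] or [E3] according to whether column [k2] is central. With the other
   columns fixed, [E2] is linear in column [k2] and [E3] in column [k3]. *)
pose E2 : pred 'M[K]_n := fun M => `[< [/\ contract T (col k1 M) \in unitmx,
  central (col k1 M) (col k2 M)
  & diagonalizable (pencil T (col k1 M) (col k2 M))] >].
pose E3 : pred 'M[K]_n := fun M => `[< ~ central (col k1 M) (col k2 M) /\
  comm_mx (pencil T (col k1 M) (col k2 M)) (pencil T (col k1 M) (col k3 M)) >].
rewrite mulr_natl -card_bool.
apply: (prob_entries_union (F := fun b : bool => if b then E2 else E3)) => [M|].
  move=> /(acceptsP M sT)[_ uC cB dB].
  have [cM|ncM] := pselect (central (col k1 M) (col k2 M)).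
    by exists true; apply/asboolP.
  by exists false; apply/asboolP.
case.
  apply: (prob_entries_col_subspace S (k := k2)) => [M a u w|M]; rewrite /E2.
    rewrite !col_set_col !eqxx /= => /asboolP[uC cu du] /asboolP[_ cw dw].
    apply/asboolP; split; first exact: uC.
      move=> x; rewrite /comm_mx pencilP mulmxDl mulmxDr.
      by rewrite -scalemxAl -scalemxAr cu cw.
    by rewrite pencilP; exact: (diagonalizable_lin a (cu w) du dw).
  (* If every column [k2] passed, all pencils would commute and be diagonalizable. *)
  apply: contrapT => /forallNP allE; apply: not_cubes.
  have {}allE u : [/\ contract T (col k1 M) \in unitmx,
      central (col k1 M) u & diagonalizable (pencil T (col k1 M) u)].
    by have /negP/negPn/asboolP := allE u; rewrite !col_set_col eqxx.
  apply: (codiagonalizable_equiv_sum_of_cubes (v := col k1 M)) => //.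
  - by have [] := allE 0.
  - by move=> u w; have [_ + _] := allE u; exact.
  - by move=> u; have [] := allE u.
apply: (prob_entries_col_subspace S (k := k3)) => [M a u w|M]; rewrite /E3.
  rewrite !col_set_col !eqxx /= => /asboolP[nc cu] /asboolP[_ cw].
  apply/asboolP; split=> //; rewrite /comm_mx pencilP mulmxDl mulmxDr.
  by rewrite -scalemxAl -scalemxAr cu cw.
(* If every column [k3] commuted, column [k2] would be central. *)
apply: contrapT => /forallNP allE.
have {}allE u : ~ central (col k1 M) (col k2 M) /\
    comm_mx (pencil T (col k1 M) (col k2 M)) (pencil T (col k1 M) u).
  by have /negP/negPn/asboolP := allE u; rewrite !col_set_col eqxx.
by have [nc _] := allE 0; apply: nc => w; have [] := allE w.
Qed.

Lemma prob_rejects_cubes_le f : equiv_sum_of_cubes f ->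
  prob_entries S (rejects n_ge3 f) <= (2 * n)%:R / #|` S|%:R.
Proof.
move=> [A uA ->]; rewrite lin_subst_P3.
have [F [sF leF]] := singular_col_subspaces n S.
(* The events are indexed by ['I_n + 'I_n]: the left copy covers singular [M], the right copy zero
   entries of [A *m col k1 M]. *)
rewrite mulr_natl mul2n -addnn -[n in (n + _)%N]card_ord.
rewrite -[X in (_ + X)%N]card_ord -card_sum.
pose Z i : pred 'M[K]_n := fun M => (A *m col k1 M) i 0 == 0.
apply: (prob_entries_union (F := fun x : 'I_n + 'I_n =>
  match x with inl k => F k | inr i => Z i end)) => [M|[k|i]]; last first.
- apply: (prob_entries_col_subspace S (k := k1)) => [M a u w|M]; rewrite /Z.
    rewrite !col_set_col !eqxx mulmxDr -scalemxAr => /eqP u0 /eqP w0.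
    by rewrite mxE [X in X + _]mxE u0 w0 mulr0 addr0.
  exists (invmx A *m delta_mx i 0).
  by rewrite col_set_col eqxx mulKVmx // mxE !eqxx oner_eq0.
- exact: leF.
move=> rej; have [uM|/sF[k Fk]] := boolP (M \in unitmx); last by exists (inl k).
have [[i Zi]|noZ] := pselect (exists i, Z i M); first by exists (inr i).
case/negP: rej; apply/acceptsP; first exact: cubes_tensor_sym.
pose d k : 'rV[K]_n := (A *m col k M)^T.
have nzd i : d k1 0 i != 0.
  by apply/negP => d0; apply: noZ; exists i; rewrite mxE in d0.
have ud : diag_mx (d k1) \in unitmx.
  by rewrite unitmxE det_diag unitfE; apply/prodf_neq0.
have uAt : A^T \in unitmx by rewrite unitmx_tr.
(* Both contractions are diagonal up to congruence by [A]; the pencil has the ratios of their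
   diagonal entries as eigenvalues. *)
pose q k := diag_mx (\row_i (d k 0 i / d k1 0 i)).
have pencilE k : pencil (cubes_tensor A) (col k1 M) (col k M) =
    invmx A *m q k *m A.
  rewrite /pencil !contract_cubes_tensor -/(d _) -/(d _).
  rewrite !invmx_mul ?unitmx_mul ?uAt // !mulmxA mulmxKV // -!mulmxA.
  congr (_ *m _); rewrite mulmxA; congr (_ *m _).
  apply: (can_inj (mulKmx ud)); rewrite mulKVmx // mulmx_diag.
  by congr diag_mx; apply/rowP => i; rewrite [RHS]mxE [X in _ * X]mxE mulrC divfK.
split=> //.
- by rewrite contract_cubes_tensor !unitmx_mul uAt ud.
- rewrite !pencilE /comm_mx !mulmxA !mulmxK // -!(mulmxA (invmx A)).
  by rewrite /q diag_mxC.
- by rewrite pencilE; exact: (diagonalizable_conj uA (diagonalizable_diag _) erefl).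
Qed.

End Algorithm.

(** * Cube roots in both fields, and the theorem *)

Lemma rcf_cbrt (R : rcfType) (c : R) : exists x, x ^+ 3 = c.
Proof.
(* As |c| <= b <= b^3, the polynomial X^3 - c is nonpositive at -b and nonnegative at b. *)
pose b := 1 + `|c|.
have b1 : 1 <= b by rewrite lerDl.
have b0 : 0 <= b := le_trans ler01 b1.
have bb : b <= b ^+ 3 by rewrite ler_eXnr.
have /andP[lec gec] : - b <= c <= b by rewrite -ler_norml lerDr ler01.
have [|x _] := @poly_ivt _ ('X^3 - c%:P) (- b) b (le_trans lec gec).
  by rewrite !hornerE exprNn -signr_odd expr1 mulN1r; apply/andP; split; lra.
by rewrite rootE !hornerE subr_eq0 => /eqP <-; exists x.
Qed.

Lemma closed_cbrt (F : closedFieldType) (c : F) : exists x, x ^+ 3 = c.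
Proof.
(* The coefficients encode X^3 = c + 0 X + 0 X^2. *)
have [x xE] := @solve_monicpoly F 3 (fun i => if i == 0%N then c else 0) isT.
exists x; rewrite xE !big_ord_recl big_ord0 /=.
by rewrite !mul0r !addr0 expr0 mulr1.
Qed.

Theorem theorem2p1 (R : realType) (K : fieldType)
    (hK : K = R :> fieldType \/ K = R[i] :> fieldType)
    (n : nat) (n_ge3 : (3 <= n)%N)
    (S : {fset K}) (S_neq0 : S != fset0)
    (f : {mpoly K[n]}) (f_homog : f \is 3.-homog) :
  (~ equiv_sum_of_cubes f ->
     1 - 2%:R / #|` S|%:R <= prob_entries S (rejects n_ge3 f)) /\
  (equiv_sum_of_cubes f ->
     1 - (2 * n)%:R / #|` S|%:R <= prob_entries S (accepts n_ge3 f)).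
Proof.
(* The choice of [K] enters through these two facts. *)
have [nz6 cbrt] : 6%:R != 0 :> K /\ forall c : K, exists x, x ^+ 3 = c.
  case: hK => ->; split; rewrite ?pnatr_eq0 //.
    exact: rcf_cbrt.
  exact: closed_cbrt.
split=> hf.
  have -> : rejects n_ge3 f = predC (accepts n_ge3 f) by [].
  by rewrite prob_entries_predC // lerD2l lerN2 prob_accepts_le.
have -> : accepts n_ge3 f = predC (rejects n_ge3 f).
  by apply/funext => M; rewrite /= negbK.
by rewrite prob_entries_predC // lerD2l lerN2 prob_rejects_cubes_le.
Qed.
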